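(* Let $A:\mathcal F\to\mathcal F$ be a mapping and let $k$ be a nonnegative integer. Let $r\ge \log 2$ and suppose that $$\bar T_{(r+k)/n}(A[f])\le \bar T_{(r+k)/n}(f)\quad\text{for all } f\in\mathcal F,\qquad\text{and}\qquad |A[\mathcal F]|\le e^{k},$$ where $A[\mathcal F]=\{A[f]: f\in\mathcal F\}$ is the range of $A$. Let $$\mathcal A=\{f-A[f]: f\in\mathcal F\},\qquad \underline{\ell}=\lfloor \log_2(r/3)\rfloor .$$ Then, with probability at least $1-2e^{-r}$, for all $f\in\mathcal F$ simultaneously, $$\mathbb E_n f(X)-\bar T_{(r+k)/n}(f)\le 2\gamma(\mathcal A;r,\underline{\ell},n)+\min\left\{2\bar T_{(2r+1)/n}(f-A[f]),\ \mathrm{rad}_{(2r+1)/n}(\mathcal A)\right\}.$$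
   Context: $X$ is a random variable with values in a space $\mathcal X$, $X_1,\dots,X_n$ are i.i.d. copies of $X$, and $\mathbb E_n f(X)=\frac1n\sum_{i=1}^n f(X_i)$ is the empirical average. $\mathbb V$ is a vector space of (measurable) functions $g:\mathcal X\to\mathbb R$ such that $\mathbb E g(X)=0$ and the set $\{\lambda\in\mathbb R:\log\mathbb E e^{\lambda g(X)}<\infty\}$ contains $0$ in its interior. $\mathcal F\subset\mathbb V$ is a finite set containing the zero function. For $s\ge 0$ and $g\in\mathbb V$, $$T_s(g)=\inf_{\lambda\ge 0}\frac{s+\log\mathbb E e^{\lambda g(X)}}{\lambda},\qquad \bar T_s(g)=\max\{T_s(g),T_s(-g)\}.$$ (Values of $\lambda$ with $\log\mathbb E e^{\lambda g(X)}=+\infty$ and the value $\lambda=0$ are excluded from the infimum, i.e. the objective there is taken to be $+\infty$.) For $g\in\mathbb V$ and $\mathcal H\subseteq\mathbb V$, $\varrho_s(g,\mathcal H)=\inf_{h\in\mathcal H}\bar T_s(g-h)$. For $\mathcal A\subseteq\mathbb V$, $\mathrm{rad}_s(\mathcal A)=\max_{a\in\mathcal A}\bar T_s(a)$. For an integer $\underline{\ell}$, $$\gamma(\mathcal A;r,\underline{\ell},n)=\inf_{(\mathcal A_i)_{i\ge0}}\ \sup_{a\in\mathcal A}\ \sum_{\ell\ge\underline{\ell}}\varrho_{(r+(r+1)2^{\ell-\underline{\ell}})/n}(a,\mathcal A_\ell),$$ where the infimum is over increasing (with respect to inclusion) sequences $(\mathcal A_i)_{i\ge0}$ of subsets of $\mathcal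 A$ with $\mathcal A_0=\{0\}$ and $|\mathcal A_i|\le 2^{2^i}$ for $i\ge1$. If $\underline{\ell}<0$, set $\mathcal A_\ell=\{0\}$ for $\ell<0$. *)

(* Defs.v *)
From HB Require Import structures.
From mathcomp Require Export all_boot all_order all_algebra finmap.
From mathcomp Require Export all_classical all_reals all_analysis.
Export Order.TTheory GRing.Theory Num.Theory.
Export numFieldNormedType.Exports.

Set Implicit Arguments.
Unset Strict Implicit.
Unset Printing Implicit Defensive.

Local Open Scope classical_set_scope.
Local Open Scope ring_scope.
Local Open Scope ereal_scope.

Definition mutually_independent (d d' : measure_display)
    (Omega : measurableType d) (T : measurableType d') (R : realType)
    (P : probability Omega R) (I : finType) (Xs : I -> {RV P >-> T}) : Prop :=
  forall (J : {set I}) (B : I -> set T), (forall i, measurable (B i)) ->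
    P (\bigcap_(i in [set` J]) (Xs i @^-1` B i)) =
    \prod_(i in J) P (Xs i @^-1` B i).

Definition iid_copies (d d' : measure_display)
    (Omega : measurableType d) (T : measurableType d') (R : realType)
    (P : probability Omega R) (X : {RV P >-> T})
    (I : finType) (Xs : I -> {RV P >-> T}) : Prop :=
  mutually_independent Xs /\
  forall i B, measurable B -> distribution P (Xs i) B = distribution P X B.

Definition empirical_mean (R : realType) (Omega T : Type) (n : nat)
    (Xs : 'I_n -> Omega -> T) (f : T -> R) (w : Omega) : R :=
  (n%:R^-1 * \sum_(i < n) f (Xs i w))%R.

Section deviation_functional.
Context (d d' : measure_display) (Omega : measurableType d)
  (T : measurableType d') (R : realType) (P : probability Omega R)
  (X : {RV P >-> T}).
Implicit Types (g h a : T -> R) (s r : R).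

Definition log_mgf g (l : R) : \bar R :=
  lne ('M_P (g \o X) l).

Definition admissible_space (V : set (T -> R)) : Prop :=
  [/\ V (cst 0%R),
      forall (c : R) g h, V g -> V h -> V (fun x => c * g x + h x)%R &
      forall g, V g ->
        [/\ measurable_fun [set: T] g,
            'E_P[g \o X] = 0 &
            [set l : R | log_mgf g l < +oo]° 0%R]].

(* Where [log_mgf g l = +oo] the objective below is [+oo], so such [l] do not
   contribute to the infimum. *)
Definition Tdev s g : \bar R :=
  ereal_inf [set (s%:E + log_mgf g l) * (l^-1)%:E | l in [set l : R | (0 < l)%R]].

Definition Tbar s g : \bar R := maxe (Tdev s g) (Tdev s (\- g)%R).

Definition varrho s g (H : set (T -> R)) : \bar R :=
  ereal_inf [set Tbar s (g \- h)%R | h in H].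

Definition rad s (A : set (T -> R)) : \bar R :=
  ereal_sup [set Tbar s a | a in A].

Definition admissible_seq (A : set (T -> R)) (S : nat -> set (T -> R)) : Prop :=
  [/\ S 0%N = [set cst 0%R],
      forall i, S i `<=` A,
      forall i, S i `<=` S i.+1 &
      forall i, (0 < i)%N -> (S i #<= `I_(2 ^ (2 ^ i))%N)%card].

Definition level (S : nat -> set (T -> R)) (l : int) : set (T -> R) :=
  if l is Posz i then S i else [set cst 0%R].

(* The sum over the integers [l >= l0] is reindexed by [l = l0 + j], [j : nat].
   If [cst 0] is not in [A] there is no admissible sequence and the infimum
   is [+oo]. *)
Definition gamma (A : set (T -> R)) r (l0 : int) (n : nat) : \bar R :=
  ereal_inf
    [set ereal_sup
       [set \sum_(0 <= j <oo)
              varrho ((r + (r + 1) * 2 ^+ j) / n%:R)%R a (level S (l0 + j%:Z)%R)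
       | a in A]
    | S in admissible_seq A].

End deviation_functional.

(* Main.v *)
(* Chernoff's bound gives P(E_n g > T_s(g)) <= exp(- n s), and T_s is
   subadditive because exp is convex. Write f = A f + a and chain a through its
   nearest points p_j in the levels l0 + j: each link p_(j+1) - p_j costs at
   most Tbar(a - p_j) + Tbar(a - p_(j+1)), so the links together cost 2 gamma.
   At level l0 + j there are at most exp(r 2^j / 3) points, so a union bound
   over the links at scale s_j = (r + (r + 1) 2^j) / n loses only
   exp(- r - 2^j). Since the index set is finite, the chain can be stopped at
   a high level N and completed by the last link a - p_N. *)
From HB Require Import structures.
Require Import Defs.
From mathcomp Require Import measurable_realfun ring lra.

Set Implicit Arguments.
Unset Strict Implicit.
Unset Printing Implicit Defensive.

Local Open Scope classical_set_scope.
Local Open Scope ring_scope.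
Local Open Scope ereal_scope.

(** The range of [A] has its own union bound: it has at most exp k elements, which the scale (r + k)
    / n absorbs at cost exp(- r), and the contraction hypothesis then replaces [A f] by [f]. The
    threshold log2(r / 3) comes from counting pairs: a link joins levels of log-size at most (r / 3)
    2^j and (r / 3) 2^(j+1), which add up to exactly r 2^j, the part of (r + 1) 2^j spent on
    entropy. The remaining 2^j makes the failure probabilities summable. The starting point p_0 is
    not zero in general; bounding its deviation produces the minimum in the statement. Two obstacles
    remain. The failure event depends on the chosen sequence of levels, while [gamma] is an infimum
    that need not be attained; likewise [Tdev] is an infimum over lambda. Both are treated by
    proving the bound with a slack 1 / (m + 1) and using continuity of the measure along an
    increasing union. Infinite values of [Tbar] and [gamma] are split off first. *)

(** * Factorisation of expectations under independence *)

Section weighted_integral.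
Context (d d' : measure_display) (Omega : measurableType d)
  (T : measurableType d') (R : realType).
Import HBNNSimple.

(** Both sides are linear and monotone-continuous in [phi], so agreement on indicators extends to
    simple functions and then to increasing limits. With [W] the product of the other factors, this
    upgrades one indicator factor of a product to a general one. *)
Lemma ge0_integral_weighted (mu : {measure set Omega -> \bar R})
    (nu : {measure set T -> \bar R}) (Y : Omega -> T) (W : Omega -> R) (c : R)
    (phi : T -> R) :
  measurable_fun setT Y -> measurable_fun setT W -> (forall w, (0 <= W w)%R) ->
  measurable_fun setT phi -> (forall t, (0 <= phi t)%R) ->
  (forall B, measurable B ->
    \int[mu]_w (\1_B (Y w) * W w)%:E = c%:E * nu B) ->
  \int[mu]_w (phi (Y w) * W w)%:E = c%:E * \int[nu]_t (phi t)%:E.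
Proof.
move=> mY mW W0 mphi phi0 muB.
have mphi' : measurable_fun setT (EFin \o phi) by exact/measurable_EFinP.
pose f_ := nnsfun_approx measurableT mphi'.
have f_cvg t : (f_ n t)%:E @[n --> \oo] --> (phi t)%:E.
  by apply: cvg_nnsfun_approx => // s _; rewrite lee_fin.
have f_nd t : nondecreasing_seq (fun n => (f_ n t)%:E).
  by move=> m n mn; rewrite lee_fin; exact/lefP/nd_nnsfun_approx.
have mf n : measurable_fun setT (fun w => f_ n (Y w)).
  exact: (measurableT_comp (measurable_funP _)).
have -> : \int[mu]_w (phi (Y w) * W w)%:E =
    limn (fun n => \int[mu]_w (f_ n (Y w) * W w)%:E).
  rewrite -monotone_convergence//.
  - apply: eq_integral => w _; apply/esym/cvg_lim => //.
    rewrite EFinM; under eq_fun do rewrite EFinM.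
    exact/cvgeZr/f_cvg.
  - by move=> n; apply/measurable_EFinP/measurable_funM.
  - by move=> n w _; rewrite lee_fin mulr_ge0.
  - by move=> w _ m n mn; rewrite lee_fin ler_wpM2r//; have := f_nd (Y w) _ _ mn.
have fE n : \int[mu]_w (f_ n (Y w) * W w)%:E = c%:E * \int[nu]_t (f_ n t)%:E.
  pose D k := f_ n @^-1` [set k].
  have mD k : measurable (D k) by exact: measurable_funPTI.
  have mI k : measurable_fun setT (fun w => \1_(D k) (Y w) * W w)%R.
    apply: measurable_funM => //.
    exact: (measurableT_comp (measurable_indic _) mY).
  under eq_integral => w _ do rewrite fimfunE mulrC mulr_fsumr -?fsumEFin//.
  under [in RHS]eq_integral => t _ do rewrite fimfunE -?fsumEFin//.
  rewrite !ge0_integral_fsum//; last 4 first.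
  - by move=> k; exact/measurable_EFinP/measurable_funM.
  - by move=> k t _; rewrite nnfun_muleindic_ge0.
  - move=> k; apply/measurable_EFinP/measurable_funM => //.
    apply: measurable_funM => //.
    exact: (measurableT_comp (measurable_indic _) mY).
  - by move=> k w _; rewrite EFinM mule_ge0 ?lee_fin// -lee_fin nnfun_muleindic_ge0.
  rewrite ge0_mule_fsumr; last first.
    by move=> k; apply: integral_ge0 => t _; rewrite nnfun_muleindic_ge0.
  apply: eq_fsbigr => k _.
  (* A negative [k] is not a value of the approximation, so both sides vanish; for the others the
     scalar can be moved out of the integral. *)
  have [k0|k0] := ltP k 0%R.
    rewrite integral0_eq; last first.
      move=> w _ /=; rewrite preimage_nnfun0// indic0 mulr0 mulr0//.
    rewrite integral0_eq ?mule0// => t _ /=.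
    by rewrite preimage_nnfun0// indic0 mulr0.
  rewrite (eq_integral (fun w => k%:E * (\1_(D k) (Y w) * W w)%:E)); last first.
    by move=> w _; rewrite -EFinM; congr EFin => /=; ring.
  rewrite ge0_integralZl_EFin//; last first.
  - exact/measurable_EFinP/mI.
  - by move=> w _; rewrite lee_fin mulr_ge0.
  rewrite muB// (eq_integral (fun t => k%:E * (\1_(D k) t)%:E)); last first.
    by move=> t _; rewrite -EFinM.
  rewrite ge0_integralZl_EFin//; last first.
    exact/measurable_EFinP/measurable_indic.
  by rewrite integral_indic// setIT muleCA.
under eq_fun do rewrite fE.
have : c%:E * \int[nu]_t (f_ n t)%:E @[n --> \oo] --> c%:E * \int[nu]_t (phi t)%:E.
  apply/cvgeZl => //.
  rewrite [X in _ --> X](_ : _ = \int[nu]_t (limn (fun n => (f_ n t)%:E))).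
    apply: cvg_monotone_convergence => //.
    - by move=> n; exact/measurable_EFinP.
    - by move=> n t _; rewrite lee_fin.
  by apply: eq_integral => t _; apply/esym/cvg_lim => //; exact: f_cvg.
by move/cvg_lim => ->.
Qed.

End weighted_integral.

Section independent_product.
Context (d d' : measure_display) (Omega : measurableType d)
  (T : measurableType d') (R : realType) (P : probability Omega R).

Lemma integral_prod_independent (I : finType) (Xs : I -> {RV P >-> T})
    (psi : I -> T -> R) :
  mutually_independent Xs ->
  (forall i, measurable_fun setT (psi i)) -> (forall i t, (0 <= psi i t)%R) ->
  (forall i, \int[P]_w (psi i (Xs i w))%:E < +oo) ->
  \int[P]_w (\prod_i psi i (Xs i w))%:E = \prod_i \int[P]_w (psi i (Xs i w))%:E.
Proof.
move=> indep mpsi psi0 psi_fin.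
(* Replace indicators by the general factors one index at a time. *)
suff H (s : seq I) (f : I -> T -> R) :
    (forall i, measurable_fun setT (f i)) -> (forall i t, (0 <= f i t)%R) ->
    (forall i, \int[P]_w (f i (Xs i w))%:E < +oo) ->
    (forall i, i \notin s -> exists2 B, measurable B & f i = \1_B) ->
    \int[P]_w (\prod_i f i (Xs i w))%:E = \prod_i \int[P]_w (f i (Xs i w))%:E.
  by apply: (H (enum I)) => // i; rewrite mem_enum.
move=> {mpsi psi0 psi_fin psi}.
have mX (B : set T) i : measurable B -> measurable (Xs i @^-1` B).
  by move=> mB; exact: measurable_funPTI.
have int_indic (B : set T) i : measurable B ->
    \int[P]_w (\1_B (Xs i w))%:E = P (Xs i @^-1` B).
  by move=> mB; rewrite -[X in P X]setIT -integral_indic//; exact: mX.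
elim: s f => [|i s IH] f mf f0 ffin find.
  (* With only indicators left, the claim is the definition of independence for the full index
     set. *)
  have /choice[B BP] : forall i, exists B, measurable B /\ f i = \1_B.
    by move=> i; have [//|B] := find i; exists B.
  have mB i : measurable (B i) by have [] := BP i.
  have fE i : f i = \1_(B i) by have [] := BP i.
  under [RHS]eq_bigr => i _ do rewrite fE int_indic//.
  have := indep [set: I]%SET B mB.
  under [X in _ = X -> _]eq_bigl => i do rewrite finset.inE.
  move=> <-.
  set D := \bigcap_(_ in _) _.
  have mD : measurable D by apply: fin_bigcap_measurable => // i _; exact: mX.
  rewrite -[X in P X]setIT -integral_indic//.
  apply: eq_integral => w _; congr EFin; rewrite indicE.
  have [wD|wD] := pselect (D w).
  - rewrite mem_set// big1// => i _; rewrite fE indicE mem_set//.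
    by apply: wD => /=; rewrite finset.inE.
  - rewrite memNset//; apply/eqP/prodf_eq0.
    apply: contrapT => nex; apply: wD => i _ /=.
    apply: contrapT => nB; apply: nex; exists i => //.
    by rewrite // fE indicE memNset.
pose W w := (\prod_(j | j != i) f j (Xs j w))%R.
pose C := \prod_(j | j != i) \int[P]_w (f j (Xs j w))%:E.
have mfX j : measurable_fun setT (fun w => f j (Xs j w)).
  exact: measurableT_comp.
have Ifin j : \int[P]_w (f j (Xs j w))%:E \is a fin_num.
  rewrite ge0_fin_numE// integral_ge0// => w _; rewrite lee_fin//.
(* Finiteness of the factors makes [C] a real constant, as the weighted transfer requires. *)
have Cfin : C \is a fin_num by apply: prode_fin_num.
have C0 : (0 <= fine C)%R.
  apply: fine_ge0; apply: prode_ge0 => j _.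
  by apply: integral_ge0 => w _; rewrite lee_fin.
rewrite [RHS](bigD1 i)//= -/C -(fineK Cfin) muleC.
rewrite -(@ge0_integral_distribution _ _ _ _ _ P (Xs i) (EFin \o f i))//; last 2 first.
  exact/measurable_EFinP.
  by move=> t; rewrite lee_fin.
rewrite -(@ge0_integral_weighted _ _ _ _ _ P _ (Xs i) W)//.
- by apply: eq_integral => w _; rewrite (bigD1 i).
- by rewrite /W; under eq_fun do rewrite -big_filter; exact: measurable_prod.
- by move=> w; apply: prodr_ge0 => j _; exact: f0.
- move=> B mB.
  (* Since [g] has an indicator at [i], the induction hypothesis applies to it and yields the
     indicator identity that the weighted transfer extends to [f i]. *)
  pose g j := if j == i then \1_B else f j.
  have gi : g i = \1_B by rewrite /g eqxx.
  have gj j : j != i -> g j = f j by rewrite /g => /negbTE ->.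
  have := IH g.
  rewrite [in RHS](bigD1 i)//= gi int_indic// muleC.
  rewrite (eq_bigr (fun j => \int[P]_w (f j (Xs j w))%:E)); last first.
    by move=> j ji; rewrite gj.
  rewrite -/C fineK// => <-.
  + apply: eq_integral => w _; rewrite [in RHS](bigD1 i)//= gi.
    congr EFin; congr (_ * _)%R.
    by apply: eq_bigr => j ji; rewrite gj.
  + move=> j; rewrite /g; case: ifP => // _; exact: measurable_indic.
  + by move=> j t; rewrite /g; case: ifP.
  + move=> j; rewrite /g; case: ifP => // _.
    by rewrite int_indic// (le_lt_trans (probability_le1 _ _)) ?ltry//; exact: mX.
  + move=> j js; have [->|ji] := eqVneq j i; first by rewrite gi; exists B.
    by rewrite gj//; apply: find; rewrite inE negb_or ji.
Qed.

End independent_product.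

(** * Nonnegativity, monotonicity and subadditivity of the functionals T_s *)

Section deviation_theory.
Context (d d' : measure_display) (Omega : measurableType d)
  (T : measurableType d') (R : realType) (P : probability Omega R)
  (X : {RV P >-> T}).

Definition centered (g : T -> R) :=
  measurable_fun [set: T] g /\ 'E_P[g \o X] = 0.

Lemma mmt_gen_funE (g : T -> R) l :
  'M_P (g \o X) l = \int[P]_w (expR (g (X w) * l))%:E.
Proof. by rewrite /mmt_gen_fun unlock. Qed.

Lemma measurable_exp_mul (Y : {RV P >-> T}) (g : T -> R) (l : R) :
  measurable_fun setT g ->
  measurable_fun setT (fun w => expR (g (Y w) * l)).
Proof.
move=> mg; apply: measurableT_comp => //; apply: measurable_funM => //.
exact: measurableT_comp.
Qed.

(* The convention oo - oo = -oo makes both parts of a finite integral finite. *)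
Lemma integral0_integrable (f : Omega -> \bar R) :
  measurable_fun setT f -> \int[P]_w f w = 0 -> P.-integrable setT f.
Proof.
move=> mf f0; apply/integrableP; split=> //; move: f0; rewrite integralE.
rewrite -[fun w => `|f w|]/(abse \o f) fune_abse.
rewrite ge0_integralD//; last 2 first.
- exact: measurable_funepos.
- exact: measurable_funeneg.
set a := \int[P]_x _; set b := \int[P]_x _.
have a0 : 0 <= a by exact: integral_ge0.
have b0 : 0 <= b by exact: integral_ge0.
by move: a b a0 b0 => [a| |] [b| |]//= _ _ _; rewrite ltry.
Qed.

Lemma centered_integrable g : centered g ->
  P.-integrable setT (fun w => (g (X w))%:E).
Proof.
move=> [mg Eg0]; apply: integral0_integrable; last by move: Eg0; rewrite unlock.
by apply/measurable_EFinP; exact: measurableT_comp.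
Qed.

Lemma centeredN g : centered g -> centered (\- g)%R.
Proof.
move=> cg; split; first exact: (measurable_funN cg.1).
rewrite unlock (eq_integral (fun w => (-1)%:E * (g (X w))%:E)); last first.
  by move=> w _; rewrite -EFinM mulN1r.
rewrite integralZl//; last exact: centered_integrable.
by have := cg.2; rewrite unlock => ->; rewrite mule0.
Qed.

(** Jensen's inequality through the tangent line: exp u >= 1 + u, and the linear term integrates to
    zero by centring. *)
Lemma mmt_gen_fun_ge1 g l : centered g -> 1 <= 'M_P (g \o X) l.
Proof.
move=> cg; rewrite mmt_gen_funE.
have gint := centered_integrable cg.
have [/eqP ->|Mfin] := boolP (\int[P]_w (expR (g (X w) * l))%:E == +oo).
  by rewrite leey.
have eint : P.-integrable setT (fun w => (expR (g (X w) * l))%:E).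
  apply/integrableP; split.
    by apply/measurable_EFinP; apply: measurable_exp_mul; case: cg.
  under eq_integral => w _ do rewrite gee0_abs ?lee_fin ?expR_ge0//.
  by rewrite ltey.
have lint : P.-integrable setT (fun w => l%:E * (g (X w))%:E).
  exact: integrableZl.
have oint : P.-integrable setT (cst (1%:E : \bar R)).
  exact: finite_measure_integrable_cst.
have <- : \int[P]_w (1 + l%:E * (g (X w))%:E) = 1.
  rewrite integralD//= integralZl// integral_cst//.
  rewrite [X in 1 * X]probability_setT mule1.
  by case: cg => _; rewrite unlock => ->; rewrite mule0 adde0.
apply: le_integral => //; first exact: integrableD.
by move=> w _; rewrite -EFinM -EFinD lee_fin mulrC expR_ge1Dx.
Qed.

Lemma log_mgf_ge0 g l : centered g -> 0 <= log_mgf X g l.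
Proof. by move=> cg; rewrite lne_ge0 mmt_gen_fun_ge1. Qed.

Lemma Tdev_ge0 s g : (0 <= s)%R -> centered g -> 0 <= Tdev X s g.
Proof.
move=> s0 cg; apply: le_ereal_inf_tmp => _ [l l0 <-].
rewrite mule_ge0//; last by rewrite lee_fin invr_ge0 ltW.
by rewrite adde_ge0// log_mgf_ge0.
Qed.

Lemma le_Tdev (s s' : R) g : (s <= s')%R -> Tdev X s g <= Tdev X s' g.
Proof.
move=> ss'; apply: le_ereal_inf_tmp => _ [l l0 <-].
apply: ge_ereal_inf; exists ((s%:E + log_mgf X g l) * (l^-1)%:E); first by exists l.
apply: lee_wpmul2r; first by rewrite lee_fin invr_ge0 ltW.
by rewrite leeD2r// lee_fin.
Qed.

(** An infinite moment generating function makes the objective +oo, so a value below [y] comes from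
    a finite one; being at least 1, it has the form exp m, which moves later computations into the
    reals. *)
Lemma Tdev_ltP s g y : centered g -> Tdev X s g < y ->
  exists l m : R, [/\ (0 < l)%R, 'M_P (g \o X) l = (expR m)%:E &
    ((s + m) / l)%:E < y].
Proof.
move=> cg /ereal_inf_lt[_ [l l0 <-]]; rewrite /log_mgf => lty.
have := mmt_gen_fun_ge1 l cg.
move: lty; case M_E: ('M_P (g \o X) l) => [a| |]//.
- move=> + a1; have a0 : (0 < a)%R by rewrite -lte_fin (lt_le_trans _ a1).
  rewrite lne_EFin// => lty; exists l, (ln a); split=> //.
    by rewrite M_E lnK// posrE.
- by rewrite /= addey// mulyr gtr0_sg ?invr_gt0// mul1e ltNge leey.
Qed.

Lemma Tdev_le s g (l m : R) : (0 < l)%R -> 'M_P (g \o X) l <= (expR m)%:E ->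
  Tdev X s g <= ((s + m) / l)%:E.
Proof.
move=> l0 Mm; apply: ge_ereal_inf; exists ((s%:E + log_mgf X g l) * (l^-1)%:E).
  by exists l.
rewrite EFinM; apply: lee_wpmul2r; first by rewrite lee_fin invr_ge0 ltW.
rewrite EFinD leeD2l//.
have -> : m%:E = lne (expR m)%:E by rewrite lne_EFin ?expR_gt0// expRK.
have M0 : 0 <= 'M_P (g \o X) l.
  by rewrite mmt_gen_funE integral_ge0// => w _; rewrite lee_fin expR_ge0.
by rewrite lee_lne// in_itv/= leey ?M0// lee_fin expR_ge0.
Qed.

(** Average the tangent bounds at the barycentre [c]; the first-order terms cancel. *)
Lemma expR_convex (t a b : R) : (0 <= t <= 1)%R ->
  (expR (t * a + (1 - t) * b) <= t * expR a + (1 - t) * expR b)%R.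
Proof.
move=> /andP[t0 t1]; set c := (t * a + (1 - t) * b)%R.
have H u : (expR c * (1 + (u - c)) <= expR u)%R.
  have -> : expR u = (expR c * expR (u - c))%R by rewrite -expRD subrKC.
  by rewrite ler_pM2l ?expR_gt0// expR_ge1Dx.
have -> : expR c = (t * (expR c * (1 + (a - c))) +
    (1 - t) * (expR c * (1 + (b - c))))%R by rewrite /c; ring.
by rewrite lerD// ler_wpM2l// subr_ge0.
Qed.

(** This is Hölder's inequality for the two exponentials. With t = l2 / (l1 + l2), the new parameter
    equals both t l1 and (1 - t) l2. Convexity is applied to the normalised exponents g l1 - m1 and
    h l2 - m2, whose exponentials have mean 1. *)
Lemma mmt_gen_funD g h (l1 l2 m1 m2 : R) :
  measurable_fun setT g -> measurable_fun setT h ->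
  (0 < l1)%R -> (0 < l2)%R ->
  'M_P (g \o X) l1 = (expR m1)%:E -> 'M_P (h \o X) l2 = (expR m2)%:E ->
  'M_P ((g \+ h)%R \o X) (l1 * l2 / (l1 + l2)) <=
    (expR (l2 / (l1 + l2) * m1 + (1 - l2 / (l1 + l2)) * m2))%:E.
Proof.
move=> mg mh l10 l20 Mg Mh.
have [t tE] : exists t, t = (l2 / (l1 + l2))%R by eexists.
rewrite -tE; set K := (t * m1 + (1 - t) * m2)%R.
have l12 : (0 < l1 + l2)%R by exact: addr_gt0.
have t01 : (0 <= t <= 1)%R.
  by rewrite tE ler_pdivrMr// mul1r lerDr (ltW l10) andbT divr_ge0// ltW.
pose c1 := (expR K * t * expR (- m1))%R.
pose c2 := (expR K * (1 - t) * expR (- m2))%R.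
have c10 : (0 <= c1)%R.
  by case/andP: t01 => t0 _; rewrite !(mulr_ge0, expR_ge0).
have c20 : (0 <= c2)%R.
  by case/andP: t01 => _ t1; rewrite !(mulr_ge0, expR_ge0)// subr_ge0.
have me1 := measurable_exp_mul X l1 mg.
have me2 := measurable_exp_mul X l2 mh.
have -> : expR K = (c1 * expR m1 + c2 * expR m2)%R.
  by rewrite /c1 /c2 -!mulrA -!expRD !addNr !expR0 !mulr1 -mulrDr subrKC mulr1.
rewrite EFinD !EFinM -Mg -Mh !mmt_gen_funE.
rewrite -!ge0_integralZl_EFin//; try (by move=> w _; rewrite lee_fin expR_ge0);
  try exact/measurable_EFinP.
rewrite -ge0_integralD//; last 4 first.
- by move=> w _; rewrite -EFinM lee_fin mulr_ge0 ?expR_ge0.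
- by apply/measurable_EFinP; exact: measurable_funM.
- by move=> w _; rewrite -EFinM lee_fin mulr_ge0 ?expR_ge0.
- by apply/measurable_EFinP; exact: measurable_funM.
apply: ge0_le_integral => //.
- apply/measurable_EFinP; apply: measurable_exp_mul.
  exact: measurable_funD.
- apply/measurable_EFinP; apply: measurable_funD; exact: measurable_funM.
move=> w _; rewrite -!EFinM -EFinD lee_fin /=.
have -> : ((g (X w) + h (X w)) * (l1 * l2 / (l1 + l2)) =
    K + (t * (g (X w) * l1 - m1) + (1 - t) * (h (X w) * l2 - m2)))%R.
  by rewrite /K tE; field; rewrite gt_eqF.
rewrite expRD (le_trans (ler_wpM2l (expR_ge0 _) (expR_convex _ _ t01)))//.
rewrite !expRD /c1 /c2 le_eqVlt; apply/orP; left; apply/eqP; ring.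
Qed.

Lemma TdevD s g h : (0 <= s)%R -> centered g -> centered h ->
  Tdev X s (g \+ h)%R <= Tdev X s g + Tdev X s h.
Proof.
move=> s0 cg ch.
have Tg0 := Tdev_ge0 s0 cg; have Th0 := Tdev_ge0 s0 ch.
have [->|Tgy] := eqVneq (Tdev X s g) +oo.
  by rewrite addye ?leey// gt_eqF// (lt_le_trans _ Th0).
have [->|Thy] := eqVneq (Tdev X s h) +oo.
  by rewrite addey ?leey// gt_eqF// (lt_le_trans _ Tg0).
have Tgf : Tdev X s g \is a fin_num by rewrite ge0_fin_numE// ltey.
have Thf : Tdev X s h \is a fin_num by rewrite ge0_fin_numE// ltey.
apply/lee_addgt0Pr => e e0.
have [l1 [m1 [l10 M1 y1]]] : exists l m : R, [/\ (0 < l)%R,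
    'M_P (g \o X) l = (expR m)%:E & ((s + m) / l)%:E < Tdev X s g + (e / 2)%:E].
  by apply: Tdev_ltP => //; rewrite lteDl// lte_fin divr_gt0.
have [l2 [m2 [l20 M2 y2]]] : exists l m : R, [/\ (0 < l)%R,
    'M_P (h \o X) l = (expR m)%:E & ((s + m) / l)%:E < Tdev X s h + (e / 2)%:E].
  by apply: Tdev_ltP => //; rewrite lteDl// lte_fin divr_gt0.
have := mmt_gen_funD cg.1 ch.1 l10 l20 M1 M2.
move=> /(Tdev_le s _) H; apply: (le_trans (H _)).
  by rewrite divr_gt0// ?mulr_gt0// addr_gt0.
(* The parameter was chosen so that its inverse is 1 / l1 + 1 / l2; the two near-optimal objectives
   then add up exactly. *)
have -> : ((s + (l2 / (l1 + l2) * m1 + (1 - l2 / (l1 + l2)) * m2)) /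
    (l1 * l2 / (l1 + l2)) = (s + m1) / l1 + (s + m2) / l2)%R.
  by field; rewrite !gt_eqF// addr_gt0.
rewrite EFinD; apply: (le_trans (leeD (ltW y1) (ltW y2))).
by rewrite addeACA -EFinD -splitr.
Qed.

Lemma Tbar_ge0 s g : (0 <= s)%R -> centered g -> 0 <= Tbar X s g.
Proof. by move=> s0 cg; rewrite le_max Tdev_ge0. Qed.

Lemma Tdev_le_Tbar s g : Tdev X s g <= Tbar X s g.
Proof. by rewrite le_max lexx. Qed.

Lemma TdevN_le_Tbar s g : Tdev X s (\- g)%R <= Tbar X s g.
Proof. by rewrite le_max lexx orbT. Qed.

Lemma le_Tbar (s s' : R) g : (s <= s')%R -> Tbar X s g <= Tbar X s' g.
Proof. by move=> ss'; rewrite ge_max !le_max !le_Tdev// orbT. Qed.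

End deviation_theory.

(** Continuity from below: it lets a bound that holds with every positive slack survive when the
    slack tends to zero. *)
Lemma mu_bigcup_nondecreasing_le d (Omega : ringOfSetsType d) (R : realFieldType)
    (mu : {measure set Omega -> \bar R}) (F : (set Omega)^nat) (p : \bar R) :
  (forall k, measurable (F k)) -> measurable (\bigcup_k F k) ->
  nondecreasing_seq F -> (forall k, mu (F k) <= p) ->
  mu (\bigcup_k F k) <= p.
Proof.
move=> mF mbF ndF Fp.
have H : mu \o F @ \oo --> mu (\bigcup_k F k) by exact: nondecreasing_cvg_mu.
rewrite -(cvg_lim (@ereal_hausdorff _) H); apply: lime_le; first exact: cvgP H.
by near=> k; exact: Fp.
Unshelve. all: by end_near. Qed.

(** * Chernoff's bound for empirical means *)

Section tail_bound.
Context (d d' : measure_display) (Omega : measurableType d)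
  (T : measurableType d') (R : realType) (P : probability Omega R)
  (X : {RV P >-> T}) (n : nat) (Xs : 'I_n -> {RV P >-> T}).
Context (n_gt0 : (0 < n)%N) (Xs_iid : iid_copies X Xs).

Lemma measurable_empirical_mean (g : T -> R) :
  measurable_fun setT g -> measurable_fun setT (empirical_mean Xs g).
Proof.
move=> mg; apply: measurable_funM => //; apply: measurable_sum => i.
exact: measurableT_comp.
Qed.

Lemma mmt_gen_fun_iid (g : T -> R) (l m : R) : measurable_fun setT g ->
  'M_P (g \o X) l = (expR m)%:E ->
  'M_P (fun w => \sum_(i < n) g (Xs i w))%R l = (expR (n%:R * m))%:E.
Proof.
move=> mg Mg; case: Xs_iid => indep ident.
rewrite /mmt_gen_fun unlock.
pose psi (i : 'I_n) t := expR (g t * l).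
have mpsi i : measurable_fun setT (psi i).
  by apply: measurableT_comp => //; exact: measurable_funM.
have psi0 i t : (0 <= psi i t)%R by exact: expR_ge0.
have Epsi i : \int[P]_w (psi i (Xs i w))%:E = (expR m)%:E.
  rewrite -Mg mmt_gen_funE.
  rewrite -(@ge0_integral_distribution _ _ _ _ _ P (Xs i) (EFin \o psi i))//.
  - rewrite -(@ge0_integral_distribution _ _ _ _ _ P X (EFin \o psi i))//.
    + by apply: eq_measure_integral => B mB _; exact: ident.
    + exact/measurable_EFinP.
    + by move=> t; rewrite lee_fin.
  - exact/measurable_EFinP.
  - by move=> t; rewrite lee_fin.
transitivity (\int[P]_w (\prod_i psi i (Xs i w))%:E).
  apply: eq_integral => w _; congr EFin.
  by rewrite /= -expR_sum mulr_suml.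
rewrite integral_prod_independent//; last by move=> i; rewrite Epsi ltry.
rewrite (eq_bigr (fun=> (expR m)%:E))//.
by rewrite prodEFin prodr_const card_ord expRM_natl.
Qed.

(** The strict gap provides one lambda with s + m < t lambda; Chernoff at this lambda gives exp(n m
    - n t lambda), which is at most exp(- n s). *)
Lemma tail_lt_Tdev (s t : R) g : centered X g -> Tdev X s g < t%:E ->
  P [set w | (t <= empirical_mean Xs g w)%R] <= (expR (- (n%:R * s)))%:E.
Proof.
move=> cg /(Tdev_ltP cg)[l [m [l0 Ml]]]; rewrite lte_fin => st.
have [mg _] := cg.
pose S w := (\sum_(i < n) g (Xs i w))%R.
have mS : measurable_fun setT S.
  by apply: measurable_sum => i; exact: measurableT_comp.
pose SV : {RV P >-> R} := HB.pack S (isMeasurableFun.Build _ _ _ _ S mS).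
have nR : (0 < n%:R :> R)%R by rewrite ltr0n.
have -> : [set w | (t <= empirical_mean Xs g w)%R] = [set w | (n%:R * t <= SV w)%R].
  by apply/seteqP; split=> w /=; rewrite /empirical_mean ler_pdivlMl.
apply: (le_trans (chernoff SV (n%:R * t) l0)).
rewrite (mmt_gen_fun_iid mg Ml) -EFinM -expRD lee_fin ler_expR.
move: st; rewrite ltr_pdivrMr// => st.
have H : (0 <= n%:R * (t * l - (s + m)))%R.
  by rewrite mulr_ge0 ?ltW// subr_gt0.
rewrite -subr_ge0; apply: le_trans H _; rewrite le_eqVlt; apply/orP; left.
by apply/eqP; ring.
Qed.

(** No single lambda need realise the infimum, so the event is exhausted by the events with
    threshold T_s + 1 / (k + 1), each using its own lambda under the same bound. *)
Lemma tail_Tdev (s : R) g : (0 <= s)%R -> centered X g ->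
  P [set w | Tdev X s g < (empirical_mean Xs g w)%:E] <=
    (expR (- (n%:R * s)))%:E.
Proof.
move=> s0 cg; have T0 := Tdev_ge0 s0 cg.
have [E|Ty] := eqVneq (Tdev X s g) +oo.
  rewrite (_ : [set _ | _] = set0) ?measure0 ?lee_fin ?expR_ge0//.
  by rewrite -subset0 => w /=; rewrite E ltNge leey.
have Tfin : Tdev X s g \is a fin_num by rewrite ge0_fin_numE// ltey.
rewrite -(fineK Tfin); set t := fine _.
pose F k := [set w | (t + k.+1%:R^-1 <= empirical_mean Xs g w)%R].
have mF k : measurable (F k).
  rewrite -[F k]setTI; apply: measurable_fun_le => //.
  by apply: measurable_empirical_mean; case: cg.
have -> : [set w | t%:E < (empirical_mean Xs g w)%:E] = \bigcup_k F k.
  apply/seteqP; split=> w /=.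
  - rewrite lte_fin => tw.
    have /ltr_add_invr[k kw] := tw.
    by exists k => //; exact: ltW.
  - by move=> [k _]; rewrite lte_fin; apply: lt_le_trans; rewrite ltrDl.
apply: mu_bigcup_nondecreasing_le => //.
- exact: bigcup_measurable.
- move=> j k jk; apply/subsetPset => w /=; apply: le_trans.
  by rewrite lerD2l lef_pV2 ?posrE// ler_nat.
- move=> k; apply: tail_lt_Tdev => //.
  by rewrite -(fineK Tfin) lte_fin ltrDl.
Qed.

End tail_bound.

(** Square 1 + 1/16 <= exp(1/16) four times, rounding down. Starting from 1 + 1/8 would give about
    2.566, below the required (3 + sqrt 5) / 2, about 2.618. *)
Lemma expR1_gt263 (R : realType) : (263 / 100 <= expR 1 :> R)%R.
Proof.
have sq (x a b : R) : (0 <= a -> b <= a ^+ 2 -> a <= expR x -> b <= expR (2 * x))%R.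
  move=> a0 ba ax; rewrite expRM_natl; apply: (le_trans ba).
  by rewrite ler_pXn2r// ?nnegrE ?expR_ge0.
have -> : (1 = 2 * (2 * (2 * (2 * (1 / 16)))) :> R)%R by field.
apply: (sq _ (1624 / 1000)%R); [lra|lra|].
apply: (sq _ (12744 / 10000)%R); [lra|lra|].
apply: (sq _ (11289 / 10000)%R); [lra|lra|].
apply: (sq _ (17 / 16)%R); [lra|lra|].
apply: le_trans (expR_ge1Dx _); lra.
Qed.

(* The condition [x^2 - 3x + 1 >= 0], i.e. [e >= (3 + sqrt 5) / 2], is what
   makes the total failure probability at most [2 exp (- r)]. *)
Lemma sum_expRN_le (R : realType) (m : nat) :
  (expR (-1) + \sum_(j < m) expR (- j.+1%:R) <= 1 :> R)%R.
Proof.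
set x := expR (-1 : R).
have x0 : (0 < x)%R by exact: expR_gt0.
have xe : (x * expR 1 = 1)%R by rewrite -expRD addNr expR0.
have := @expR1_gt263 R; move: (expR 1) xe => e xe e263.
(* The value 0.3803 lies between 1 / 2.63 and (3 - sqrt 5) / 2, the smaller root of x^2 - 3x + 1. *)
have x1 : (x <= 3803 / 10000)%R by nra.
have -> : (\sum_(j < m) expR (- j.+1%:R) = \sum_(j < m) x ^+ j.+1 :> R)%R.
  by apply: eq_bigr => j _; rewrite -expRM_natl mulrN1.
have H : ((1 - x) * \sum_(j < m) x ^+ j.+1 <= x)%R.
  rewrite (_ : _ * _ = x - x ^+ m.+1)%R; first by rewrite gerBl exprn_ge0// ltW.
  elim: m => [|m IH]; first by rewrite big_ord0 expr1 mulr0 subrr.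
  by rewrite big_ord_recr/= mulrDr IH !exprS; ring.
move: (\sum_(j < m) _)%R H => S H; nra.
Qed.

(** * Deterministic chaining, nearest points and union bounds *)

Section chaining.
Context (d d' : measure_display) (Omega : measurableType d)
  (T : measurableType d') (R : realType) (P : probability Omega R)
  (X : {RV P >-> T}).

Lemma empirical_meanD n (Xs : 'I_n -> Omega -> T) (g h : T -> R) w :
  empirical_mean Xs (g \+ h)%R w =
  (empirical_mean Xs g w + empirical_mean Xs h w)%R.
Proof. by rewrite /empirical_mean -mulrDr -big_split. Qed.

(** A link is the difference of a - p_j and a - p_(j+1), so subadditivity needs one of them with a
    minus sign; this is what the two-sided [Tbar] covers. The second term is then raised from scale
    s_j to s_(j+1), so that only matching scales occur. *)
Lemma chaining_bound (e : (T -> R) -> R) (s : nat -> R) (a : T -> R)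
    (p : nat -> T -> R) (N : nat) (c : \bar R) :
  (forall g h, e (g \+ h)%R = (e g + e h)%R) ->
  (forall j, 0 <= s j)%R -> (forall j, s j <= s j.+1)%R ->
  (forall j, centered X (a \- p j)%R) -> 
  (e (p 0%N))%:E <= c ->
  (forall j, (j < N)%N ->
    (e (p j.+1 \- p j)%R)%:E <= Tdev X (s j) (p j.+1 \- p j)%R) ->
  (e (a \- p N)%R)%:E <= Tdev X (s N) (a \- p N)%R ->
  (e a)%:E <= c + 2%:E * \sum_(j < N.+1) Tbar X (s j) (a \- p j)%R.
Proof.
move=> eD s0 s_nd cen ep0 elink elast.
pose b j := Tbar X (s j) (a \- p j)%R.
have b0 j : 0 <= b j by exact: Tbar_ge0.
have link j : (j < N)%N -> (e (p j.+1 \- p j)%R)%:E <= b j + b j.+1.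
  move=> jN; apply: (le_trans (elink j jN)).
  have -> : (p j.+1 \- p j)%R = ((a \- p j) \+ (\- (a \- p j.+1)))%R.
    by apply/funext => t /=; ring.
  apply: (le_trans (TdevD (s0 j) (cen j) (centeredN (cen j.+1)))).
  apply: leeD; first exact: Tdev_le_Tbar.
  exact: (le_trans (TdevN_le_Tbar _ _ _) (le_Tbar _ _ (s_nd j))).
have c_ge : -oo < c by apply: lt_le_trans ep0; rewrite ltNyr.
(* The invariant counts each earlier distance twice, as the end of one link and the start of the
   next, and the current one once; the last link a - p_N supplies the second copy of b_N. *)
suff H j : (j <= N)%N -> (e (p j))%:E <=
    c + (\sum_(i < j) b i + \sum_(i < j) b i) + b j.
  have -> : a = ((a \- p N) \+ p N)%R by apply/funext => t /=; ring.
  rewrite eD EFinD addeC.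
  apply: (le_trans (leeD (H N (leqnn N)) (le_trans elast (Tdev_le_Tbar _ _ _)))).
  have -> : ((a \- p N) \+ p N)%R = a by apply/funext => t /=; ring.
  rewrite big_ord_recr/= -/(b N) (_ : 2%:E = 1 + 1)// ge0_muleDl// mul1e.
  by rewrite [X in _ <= _ + X]addeACA !addeA.
elim: j => [_|j IH jN].
  by rewrite !big_ord0 !adde0; apply: (le_trans ep0); rewrite leeDl.
have -> : p j.+1 = ((p j.+1 \- p j) \+ p j)%R by apply/funext => t /=; ring.
rewrite eD EFinD addeC.
apply: (le_trans (leeD (IH (ltnW jN)) (link j jN))).
rewrite !big_ord_recr/= -/(b j) [X in _ <= _ + X + _]addeACA !addeA.
exact: lexx.
Qed.

Lemma seq_argmin (I : eqType) (f : I -> \bar R) (q : seq I) x0 : x0 \in q ->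
  exists2 x, x \in q & forall y, y \in q -> f x <= f y.
Proof.
elim: q x0 => // y q IH _ _.
case: q IH => [_|z q IH].
  by exists y; rewrite ?mem_head// => t; rewrite inE => /eqP ->.
have [x xq xmin] := IH z (mem_head _ _).
have [yx|xy] := leP (f y) (f x).
  exists y; rewrite ?mem_head// => t; rewrite inE => /predU1P[->//|/xmin].
  exact: le_trans.
exists x; first by rewrite inE xq orbT.
by move=> t; rewrite inE => /predU1P[->|/xmin//]; exact: ltW.
Qed.

Lemma varrho_attained (s : R) a (q : seq (T -> R)) h0 : h0 \in q ->
  exists2 h, h \in q & varrho X s a [set` q] = Tbar X s (a \- h)%R.
Proof.
move=> /(seq_argmin (fun h => Tbar X s (a \- h)%R))[h hq hmin].
exists h => //; apply/eqP; rewrite eq_le; apply/andP; split.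
  by apply: ge_ereal_inf; exists (Tbar X s (a \- h)%R) => //; exists h.
by apply: le_ereal_inf_tmp => _ [y yq <-]; exact: hmin.
Qed.

Lemma mu_bigsetU_le_sum (I : eqType) (q : seq I) (F : I -> set Omega)
    (p : I -> R) :
  (forall i, i \in q -> measurable (F i)) ->
  (forall i, i \in q -> P (F i) <= (p i)%:E) ->
  measurable (\bigcup_(i in [set` q]) F i) /\
  P (\bigcup_(i in [set` q]) F i) <= (\sum_(i <- q) p i)%:E.
Proof.
elim: q => [_ _|i q IH mF Fp].
  by rewrite set_nil bigcup_set0 measure0 big_nil.
have [mq Pq] : measurable (\bigcup_(i in [set` q]) F i) /\
    P (\bigcup_(i in [set` q]) F i) <= (\sum_(i <- q) p i)%:E.
  by apply: IH => j jq; [apply: mF|apply: Fp]; rewrite inE jq orbT.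
have mi : measurable (F i) by apply: mF; exact: mem_head.
have -> : [set` i :: q] = i |` [set` q].
  by apply/seteqP; split=> j /=; rewrite inE => /predU1P.
rewrite bigcup_setU1; split; first exact: measurableU.
apply: le_trans; first exact: (measureU2 P mi mq).
by rewrite big_cons EFinD leeD// Fp// mem_head.
Qed.

Lemma mu_bigsetU_le (I : eqType) (q : seq I) (F : I -> set Omega) (p : R) :
  (forall i, i \in q -> measurable (F i)) ->
  (forall i, i \in q -> P (F i) <= p%:E) ->
  measurable (\bigcup_(i in [set` q]) F i) /\
  P (\bigcup_(i in [set` q]) F i) <= ((size q)%:R * p)%:E.
Proof.
move=> mF Fp.
have -> : ((size q)%:R * p = \sum_(i <- q) p)%R.
  by rewrite big_const_seq count_predT iter_addr addr0 mulr_natl.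
exact: mu_bigsetU_le_sum.
Qed.

End chaining.

(** * One exceptional event for all the links *)

Section deviations_along_chains.
Context (d d' : measure_display) (Omega : measurableType d)
  (T : measurableType d') (R : realType) (P : probability Omega R)
  (X : {RV P >-> T}) (n : nat) (Xs : 'I_n -> {RV P >-> T}).
Context (n_gt0 : (0 < n)%N) (Xs_iid : iid_copies X Xs).

Lemma measurable_dev (t : \bar R) g : measurable_fun setT g ->
  measurable [set w | t < (empirical_mean Xs g w)%:E].
Proof.
move=> mg; rewrite -[X in measurable X]setTI.
apply: emeasurable_fun_o_infty => //; apply/measurable_EFinP.
exact: measurable_empirical_mean.
Qed.

Lemma union_tail_Tdev (s : R) (q : seq (T -> R)) : (0 <= s)%R ->
  (forall g, g \in q -> centered X g) ->
  exists B, [/\ measurable B,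
    P B <= ((size q)%:R * expR (- (n%:R * s)))%:E &
    forall w, ~ B w -> forall g, g \in q ->
      (empirical_mean Xs g w)%:E <= Tdev X s g].
Proof.
move=> s0 cq.
pose F g := [set w | Tdev X s g < (empirical_mean Xs g w)%:E].
have [mF PF] : measurable (\bigcup_(g in [set` q]) F g) /\
    P (\bigcup_(g in [set` q]) F g) <= ((size q)%:R * expR (- (n%:R * s)))%:E.
  apply: mu_bigsetU_le => g gq; first by apply: measurable_dev; case: (cq g gq).
  exact: tail_Tdev n_gt0 Xs_iid _ _ s0 (cq g gq).
exists (\bigcup_(g in [set` q]) F g); split=> // w nB g gq.
by rewrite leNgt; apply/negP => H; apply: nB; exists g.
Qed.

Definition scale (r : R) (j : nat) : R := ((r + (r + 1) * 2 ^+ j) / n%:R)%R.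

Lemma scale_ge0 r j : (0 <= r)%R -> (0 <= scale r j)%R.
Proof. by move=> r0; rewrite divr_ge0// addr_ge0// mulr_ge0 ?addr_ge0// exprn_ge0. Qed.

Lemma le_scaleS r j : (0 <= r)%R -> (scale r j <= scale r j.+1)%R.
Proof.
move=> r0; rewrite ler_pM2r ?invr_gt0 ?ltr0n// lerD2l ler_wpM2l ?addr_ge0//.
by rewrite exprS ler_peMl ?exprn_ge0// ler1n.
Qed.

(** The failure budget is exp(- r) for [q0], exp(- r - 1) for the starting points, and exp(- r - (j
    + 1)) for the links from level j. The last two groups together cost at most another exp(- r). *)
Lemma chain_deviations (r : R) (k N : nat) (q0 : seq (T -> R))
    (q : nat -> seq (T -> R)) :
  (0 <= r)%R ->
  (forall g, g \in q0 -> centered X g) ->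
  (forall h, h \in q 0%N -> centered X h) ->
  (forall j h h', h \in q j -> h' \in q j.+1 -> centered X (h' \- h)%R) ->
  ((size q0)%:R <= expR k%:R :> R)%R ->
  (forall j, (j <= N.+1)%N -> (size (q j))%:R <= expR (r / 3 * 2 ^+ j) :> R)%R ->
  exists B, [/\ measurable B, P B <= (2 * expR (- r))%:E &
    forall w, ~ B w -> [/\
      forall g, g \in q0 ->
        (empirical_mean Xs g w)%:E <= Tdev X ((r + k%:R) / n%:R)%R g,
      forall h, h \in q 0%N ->
        (empirical_mean Xs h w)%:E <= Tdev X (scale r 0) h &
      forall j h h', (j <= N)%N -> h \in q j -> h' \in q j.+1 ->
        (empirical_mean Xs (h' \- h)%R w)%:E <= Tdev X (scale r j) (h' \- h)%R]].
Proof.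
move=> r0 cq0 cq cqq sq0 sq.
have nR : n%:R != 0%R :> R by rewrite pnatr_eq0 -lt0n.
have nscale j : (n%:R * scale r j = r + (r + 1) * 2 ^+ j)%R.
  by rewrite /scale mulrC divfK.
have [|B0 [mB0 PB0 hB0]] := @union_tail_Tdev ((r + k%:R) / n%:R)%R q0 _ cq0.
  by rewrite divr_ge0// addr_ge0.
have [B1 [mB1 PB1 hB1]] := union_tail_Tdev (scale_ge0 0 r0) cq.
pose links j := [seq (h' \- h)%R | h <- q j, h' <- q j.+1].
have clinks j g : g \in links j -> centered X g.
  by move=> /allpairsP[[h h'] /= [hq h'q ->]]; exact: cqq hq h'q.
have /choice[B2 B2P] : forall j, exists B, [/\ measurable B,
    P B <= ((size (links j))%:R * expR (- (n%:R * scale r j)))%:E &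
    forall w, ~ B w -> forall g, g \in links j ->
      (empirical_mean Xs g w)%:E <= Tdev X (scale r j) g].
  by move=> j; apply: union_tail_Tdev; [exact: scale_ge0|exact: clinks].
pose U := \bigcup_(j in [set` iota 0 N.+1]) B2 j.
have [mU PU] : measurable U /\
    P U <= (\sum_(j <- iota 0 N.+1) expR (- r) * expR (- j.+1%:R))%:E.
  apply: mu_bigsetU_le_sum => j; rewrite mem_iota add0n => /andP[_ jN].
    by have [] := B2P j.
  have [_ + _] := B2P j; move=> /le_trans; apply; rewrite lee_fin.
  rewrite size_allpairs natrM nscale.
  have H : ((size (q j))%:R * (size (q j.+1))%:R <= expR (r * 2 ^+ j) :> R)%R.
    apply: (le_trans (ler_pM _ _ (sq j _) (sq j.+1 _))) => //; first exact: leqW.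
    by rewrite -expRD ler_expR exprS le_eqVlt; apply/orP; left; apply/eqP; field.
  apply: (le_trans (ler_wpM2r (expR_ge0 _) H)).
  rewrite -!expRD ler_expR.
  (* Weakening 2^j to j + 1 turns the failure probabilities into a geometric series. *)
  have : (j.+1%:R <= 2 ^+ j :> R)%R by rewrite -natrX ler_nat ltn_expl.
  move: (2 ^+ j)%R => y; lra.
exists (B0 `|` (B1 `|` U)); split.
- by apply: measurableU => //; exact: measurableU.
- apply: le_trans; first exact: (measureU2 P mB0 (measurableU _ _ mB1 mU)).
  apply: (@le_trans _ _ (expR (- r) + (expR (- r) * expR (-1) +
      \sum_(j <- iota 0 N.+1) expR (- r) * expR (- j.+1%:R)))%:E).
    rewrite EFinD leeD//.
      apply: (le_trans PB0); rewrite lee_fin.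
      apply: (le_trans (ler_wpM2r (expR_ge0 _) sq0)).
      by rewrite -expRD ler_expR mulrC divfK// opprD addrCA subrr addr0.
    apply: le_trans; first exact: (measureU2 P mB1 mU).
    rewrite EFinD leeD//; apply: (le_trans PB1); rewrite lee_fin nscale.
    (* Here r / 3 - (2 r + 1) <= - r - 1. *)
    apply: (le_trans (ler_wpM2r (expR_ge0 _) (sq 0%N _))) => //.
    by rewrite -!expRD ler_expR expr0; lra.
  rewrite lee_fin -mulr_sumr -mulrDr -[X in (X + _)%R]mulr1 -mulrDr mulrC.
  rewrite ler_wpM2r ?expR_ge0// -[leRHS]/(1 + 1)%R lerD2l.
  by rewrite -[iota 0 N.+1]/(index_iota 0 N.+1) big_mkord sum_expRN_le.
- move=> w nB.
  have nB0 : ~ B0 w by move=> H; apply: nB; left.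
  have nB1 : ~ B1 w by move=> H; apply: nB; right; left.
  split; [exact: hB0|exact: hB1|].
  move=> j h h' jN hq h'q.
  have [_ _ +] := B2P j; apply; last by apply/allpairsP; exists (h, h').
  move=> H; apply: nB; right; right; exists j => //.
  by suff : j \in iota 0 N.+1 by []; rewrite mem_iota.
Qed.

End deviations_along_chains.

(** * Cardinalities of the levels *)

Section levels.
Context (d : measure_display) (T : measurableType d) (R : realType).

Lemma floor_log2_level (x : R) (i j : nat) : (0 < x)%R ->
  (Num.floor (ln x / ln 2) + j%:Z = i%:Z)%R -> (2 ^+ i <= x * 2 ^+ j :> R)%R.
Proof.
move=> x0 E.
have l2 : (0 < ln 2 :> R)%R by rewrite ln_gt0// ltr1n.
have pow2 m : (2 ^+ m = expR (m%:R * ln 2) :> R)%R by rewrite expRM_natl lnK ?posrE.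
rewrite !pow2 -[X in (_ <= X * _)%R]lnK ?posrE// -expRD ler_expR.
have -> : (i%:R = (Num.floor (ln x / ln 2))%:~R + j%:R :> R)%R.
  by rewrite -[i%:R%R]/(i%:~R)%R -E intrD.
by rewrite mulrDl lerD2r -ler_pdivlMr// floor_le.
Qed.

(** A level of nonpositive index is the singleton of zero. At a positive index i = l0 + j, the
    cardinality is at most 2^(2^i) <= exp(2^i), and rounding down the logarithm gives 2^i <= x 2^j.
    Zero is inherited from [S 0] by monotonicity. *)
Lemma level_seq (A : set (T -> R)) (S : nat -> set (T -> R)) (x : R) (j : nat) :
  finite_set A -> admissible_seq A S -> (0 < x)%R ->
  exists q : seq (T -> R),
    [/\ level S (Num.floor (ln x / ln 2) + j%:Z)%R = [set` q],
        [set` q] `<=` A, cst 0%R \in q &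
        ((size q)%:R <= expR (x * 2 ^+ j) :> R)%R].
Proof.
move=> finA [S0 SA Snd Scard] x0.
have A0 : A (cst 0%R) by apply: (SA 0%N); rewrite S0.
have seq1 : exists q : seq (T -> R),
    [/\ [set cst 0%R] = [set` q], [set` q] `<=` A, cst 0%R \in q &
        ((size q)%:R <= expR (x * 2 ^+ j) :> R)%R].
  exists [:: cst 0%R]; split.
  - by apply/seteqP; split=> g /=; rewrite inE => /eqP.
  - by move=> g /=; rewrite inE => /eqP ->.
  - exact: mem_head.
  - rewrite -expR0 ler_expR mulr_ge0 ?ltW//; exact: exprn_gt0.
case E : (Num.floor _ + _)%R => [i|i]; last exact: seq1.
case: i E => [|i] E; first by rewrite /level S0; exact: seq1.
have finS : finite_set (S i.+1) by apply: sub_finite_set finA.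
exists (fset_set (S i.+1)); split.
- by rewrite /level fset_setK.
- by rewrite fset_setK//; exact: SA.
- rewrite -[_ \in _]/(_ \in fset_set _) in_fset_set// inE.
  elim: i.+1 => [|m IH]; first by rewrite S0.
  exact: Snd.
- have := geq_card_fset_set (Scard i.+1 isT).
  rewrite -(ler_nat R) => /le_trans; apply.
  rewrite natrX; apply: (@le_trans _ _ (expR 1 ^+ (2 ^ i.+1)%N)%R).
    rewrite ler_pXn2r ?nnegrE ?expR_ge0 ?expn_gt0//.
    by apply: le_trans (expR1_gt263 R); lra.
  by rewrite -expRM_natr mul1r ler_expR natrX floor_log2_level.
Qed.

(** With [M] the size of the whole index set, this finds a level whose cardinality budget admits the
    whole set, which is where the chain may stop. *)
Lemma exists_level_ge (x M : R) : (0 < x)%R -> exists N : nat,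
  (M <= expR (x * 2 ^+ N.+1))%R.
Proof.
move=> x0; exists (Num.trunc (M / x)).
set N := Num.trunc _.
have MN : (M <= x * N.+1%:R)%R.
  by rewrite mulrC -ler_pdivrMr// ltW// truncnS_gt.
apply: (le_trans MN); apply: le_trans (ltW (expR_gt1Dx _)); last first.
  by rewrite gt_eqF// mulr_gt0// exprn_gt0.
rewrite (@le_trans _ _ (x * 2 ^+ N.+1))%R ?lerDr//.
by rewrite ler_pM2l// -natrX ler_nat ltnW// ltn_expl.
Qed.

End levels.

Section admissible_space_theory.
Context (d d' : measure_display) (Omega : measurableType d)
  (T : measurableType d') (R : realType) (P : probability Omega R)
  (X : {RV P >-> T}) (V : set (T -> R)).
Context (V_adm : admissible_space X V).

Lemma admissible_centered g : V g -> centered X g.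
Proof. by case: V_adm => _ _ H /H []. Qed.

Lemma admissible_sub g h : V g -> V h -> V (g \- h)%R.
Proof.
case: V_adm => _ H _ Vg Vh.
have -> : (g \- h)%R = (fun x => -1 * h x + g x)%R.
  by apply/funext => x /=; ring.
exact: H.
Qed.

Lemma varrho_ge0 s g (H : set (T -> R)) : (0 <= s)%R -> V g -> H `<=` V ->
  0 <= varrho X s g H.
Proof.
move=> s0 Vg HV; apply: le_ereal_inf_tmp => _ [h Hh <-].
exact: Tbar_ge0 s0 (admissible_centered (admissible_sub Vg (HV _ Hh))).
Qed.

End admissible_space_theory.

(** * The bound for one sequence of levels, then for the infimum over sequences *)

Section multiscale_bound.
Context (d d' : measure_display) (Omega : measurableType d)
  (T : measurableType d') (R : realType) (P : probability Omega R)
  (X : {RV P >-> T}) (n : nat) (Xs : 'I_n -> {RV P >-> T})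
  (V F : set (T -> R)) (A : (T -> R) -> (T -> R)) (k : nat) (r : R).
Context (n_gt0 : (0 < n)%N) (Xs_iid : iid_copies X Xs)
  (V_adm : admissible_space X V) (FV : F `<=` V) (F_fin : finite_set F)
  (F0 : F (cst 0%R)) (A_F : forall f, F f -> F (A f)) (r_gt0 : (0 < r)%R)
  (A_contr : forall f, F f ->
     Tbar X ((r + k%:R) / n%:R)%R (A f) <= Tbar X ((r + k%:R) / n%:R)%R f)
  (A_card : ((#|` fset_set (A @` F)|)%:R <= expR k%:R :> R)%R).

Let calA : set (T -> R) := [set (f \- A f)%R | f in F].
Let l0 : int := Num.floor (ln (r / 3) / ln 2)%R.
Let offset f := mine (2%:E * Tbar X ((2 * r + 1) / n%:R)%R (f \- A f)%R)
  (rad X ((2 * r + 1) / n%:R)%R calA).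
Let excess f w := (empirical_mean Xs f w)%:E - Tbar X ((r + k%:R) / n%:R)%R f.

Let chain_value (S : nat -> set (T -> R)) := ereal_sup
  [set \sum_(0 <= j <oo)
         varrho X ((r + (r + 1) * 2 ^+ j) / n%:R)%R a (level S (l0 + j%:Z)%R)
  | a in calA].

Let r_ge0 : (0 <= r)%R. Proof. exact: ltW. Qed.
Let r3_gt0 : (0 < r / 3)%R. Proof. by rewrite divr_gt0. Qed.

Let calAV : calA `<=` V.
Proof.
by move=> _ [f Ff <-]; apply: (admissible_sub V_adm); apply: FV => //; exact: A_F.
Qed.

Let calA_fin : finite_set calA. Proof. exact: finite_image. Qed.

Lemma chain_value_ge0 S : admissible_seq calA S -> 0 <= chain_value S.
Proof.
(* A witness that [calA] is nonempty; the supremum over an empty set would be -oo. *)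
move=> S_adm; have Aa : calA (cst 0%R \- A (cst 0%R))%R by exists (cst 0%R).
apply: le_trans (ereal_sup_ubound _); last by exists (cst 0%R \- A (cst 0%R))%R.
apply: nneseries_ge0 => j _ _; apply: (varrho_ge0 V_adm).
- exact: (scale_ge0 n).
- exact: calAV.
- have [q [-> qA _ _]] := level_seq j calA_fin S_adm r3_gt0.
  by move=> h /qA /calAV.
Qed.

Lemma excess_le_chain_value S : admissible_seq calA S ->
  exists B, [/\ measurable B, P B <= (2 * expR (- r))%:E &
    forall w, ~ B w -> forall f, F f ->
      excess f w <= 2%:E * chain_value S + offset f].
Proof.
move=> S_adm.
have /choice[q qP] := fun j => level_seq j calA_fin S_adm r3_gt0.
have qA j : [set` q j] `<=` calA by have [] := qP j.
have q0 j : cst 0%R \in q j by have [] := qP j.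
have levelE j : level S (l0 + j%:Z)%R = [set` q j] by have [] := qP j.
have [N calA_N] := exists_level_ge ((#|` fset_set calA|)%:R) r3_gt0.
(* Beyond N the level is replaced by all of [calA], so that a - p_N is an ordinary link from level N
   to level N + 1 and falls under the same union bound. *)
pose q' j : seq (T -> R) := if (j <= N)%N then q j else fset_set calA.
have q'A j h : h \in q' j -> calA h.
  rewrite /q'; case: ifP => _; first exact: qA.
  by rewrite -[_ \in _]/(_ \in fset_set _) in_fset_set// inE.
have cen h : V h -> centered X h by exact: admissible_centered.
have [B [mB PB hB]] : exists B, [/\ measurable B, P B <= (2 * expR (- r))%:E &
    forall w, ~ B w -> [/\
      forall g, g \in (fset_set (A @` F) : seq _) ->
        (empirical_mean Xs g w)%:E <= Tdev X ((r + k%:R) / n%:R)%R g,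
      forall h, h \in q' 0%N ->
        (empirical_mean Xs h w)%:E <= Tdev X (scale n r 0) h &
      forall j h h', (j <= N)%N -> h \in q' j -> h' \in q' j.+1 ->
        (empirical_mean Xs (h' \- h)%R w)%:E <= Tdev X (scale n r j) (h' \- h)%R]].
  apply: chain_deviations => //.
  - move=> g; rewrite -[_ \in _]/(_ \in fset_set _) in_fset_set; last exact: finite_image.
    by rewrite inE => -[f Ff <-]; exact/cen/FV/A_F.
  - by move=> h /q'A /calAV /cen.
  - by move=> j h h' /q'A hA /q'A h'A; apply: cen; apply: (admissible_sub V_adm); exact: calAV.
  - move=> j; rewrite leq_eqVlt ltnS /q' => /predU1P[->|jN].
      by rewrite ltnn.
    by rewrite jN; have [] := qP j.
exists B; split=> // w /hB[hA h0 hlink] f Ff.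
set a := (f \- A f)%R.
have Aa : calA a by exists f.
have /choice[p pP] : forall j, exists h, h \in q j /\
    varrho X (scale n r j) a [set` q j] = Tbar X (scale n r j) (a \- h)%R.
  by move=> j; have [h] := varrho_attained X (scale n r j) a (q0 j); exists h.
have pq j : p j \in q j by have [] := pP j.
have pmin j : varrho X (scale n r j) a [set` q j] = Tbar X (scale n r j) (a \- p j)%R.
  by have [] := pP j.
have cap j : centered X (a \- p j)%R.
  by apply: cen; apply: (admissible_sub V_adm); apply: calAV => //; exact: qA (pq j).
have s0 : scale n r 0 = ((2 * r + 1) / n%:R)%R.
  by rewrite /scale expr0; congr (_ / _)%R; ring.
have ca : centered X a by exact/cen/calAV.
(* The radius bounds p_0 because p_0 lies in [calA]. For the other branch, p_0 = a - (a - p_0), and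
   a - p_0 costs at most [Tbar] of [a], since zero belongs to the level and p_0 is a nearest
   point. *)
have first_link : (empirical_mean Xs (p 0%N) w)%:E <= offset f.
  have H : (empirical_mean Xs (p 0%N) w)%:E <= Tdev X (scale n r 0) (p 0%N).
    by apply: h0; rewrite /q' leq0n.
  rewrite /offset -s0 le_min; apply/andP; split; last first.
    apply: (le_trans H); apply: (le_trans (Tdev_le_Tbar _ _ _)).
    by apply: ereal_sup_ubound; exists (p 0%N) => //; exact: qA (pq 0%N).
  apply: (le_trans H).
  have -> : p 0%N = (a \+ (\- (a \- p 0%N)))%R by apply/funext => t /=; ring.
  apply: (le_trans (TdevD (scale_ge0 n 0 r_ge0) ca (centeredN (cap 0%N)))).
  rewrite (_ : 2%:E = 1 + 1)// ge0_muleDl// mul1e leeD ?Tdev_le_Tbar//.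
  apply: (le_trans (TdevN_le_Tbar _ _ _)); rewrite -pmin.
  apply: ge_ereal_inf; exists (Tbar X (scale n r 0) (a \- cst 0)%R).
    by exists (cst 0%R) => //; exact: q0.
  by rewrite (_ : (a \- cst 0)%R = a)//; apply/funext => t /=; rewrite subr0.
have chained : (empirical_mean Xs a w)%:E <=
    offset f + 2%:E * \sum_(j < N.+1) Tbar X (scale n r j) (a \- p j)%R.
  apply: (@chaining_bound _ _ _ _ _ _ X (empirical_mean Xs ^~ w)) => //.
  - by move=> g h; exact: empirical_meanD.
  - by move=> j; exact: scale_ge0.
  - by move=> j; exact: le_scaleS.
  - by move=> j jN; apply: hlink; rewrite /q' ?jN ?(ltnW jN).
  - apply: hlink; rewrite /q' ?leqnn// ltnn.
    by rewrite -[_ \in _]/(_ \in fset_set _) in_fset_set// inE.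
rewrite /excess.
set t := Tbar _ _ _.
have Af_le : (empirical_mean Xs (A f) w)%:E <= t.
  apply: le_trans (A_contr Ff); apply: le_trans (Tdev_le_Tbar _ _ _).
  apply: hA; rewrite -[_ \in _]/(_ \in fset_set _) in_fset_set; last exact: finite_image.
  by rewrite inE; exists f.
(* If [t] is infinite, the excess is -oo and nothing is left to prove. *)
have [->|ty] := eqVneq t +oo; first by rewrite leNye.
have tfin : t \is a fin_num.
  rewrite ge0_fin_numE ?ltey//; apply: Tbar_ge0; last exact/cen/FV.
  by rewrite divr_ge0// addr_ge0.
rewrite leeBlDr//.
have -> : empirical_mean Xs f w = (empirical_mean Xs a w + empirical_mean Xs (A f) w)%R.
  rewrite -empirical_meanD; congr empirical_mean.
  by apply/funext => x /=; rewrite subrK.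
rewrite EFinD leeD//; apply: (le_trans chained); rewrite addeC leeD2r//.
rewrite lee_pmul2l//; apply: le_trans (ereal_sup_ubound _); last by exists a.
(* The truncated chain is a partial sum of the series in [chain_value], whose terms are
   nonnegative. *)
have -> : \sum_(j < N.+1) Tbar X (scale n r j) (a \- p j)%R =
    \sum_(0 <= j < N.+1) varrho X (scale n r j) a (level S (l0 + j%:Z)%R).
  by rewrite big_mkord; apply: eq_bigr => j _; rewrite levelE pmin.
apply: nneseries_lim_ge => j _ _; apply: (varrho_ge0 V_adm).
- exact: scale_ge0.
- exact: calAV.
- by rewrite levelE => h /qA /calAV.
Qed.

Lemma offset_ge0 f : F f -> 0 <= offset f.
Proof.
move=> Ff; have Aa : calA (f \- A f)%R by exists f.
have T0 : 0 <= Tbar X ((2 * r + 1) / n%:R)%R (f \- A f)%R.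
  apply: Tbar_ge0; last exact/(admissible_centered V_adm)/calAV.
  by rewrite divr_ge0// addr_ge0// mulr_ge0.
rewrite le_min mule_ge0//=; apply: (le_trans T0).
by apply: ereal_sup_ubound; exists (f \- A f)%R.
Qed.

Lemma measurable_excess f (c : \bar R) : F f ->
  measurable [set w | c < excess f w].
Proof.
move=> Ff; rewrite -[X in measurable X]setTI.
apply: emeasurable_fun_o_infty => //; apply: emeasurable_funB => //.
apply/measurable_EFinP; apply: measurable_empirical_mean.
by have [] := admissible_centered V_adm (FV Ff).
Qed.

(** Each sequence of levels has its own exceptional set, so these sets cannot simply be united over
    all sequences. Instead the failure event is the increasing union of the events [D m] with slack
    1 / (m + 1), and each [D m] needs only one near-optimal sequence. *)
Lemma excess_le_gamma :
  (1 - 2 * expR (- r))%R%:E <=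
  P [set w | forall f, F f ->
       excess f w <= 2%:E * gamma X calA r l0 n + offset f].
Proof.
set g := gamma _ _ _ _ _.
have g0 : 0 <= g.
  by apply: le_ereal_inf_tmp => _ [S S_adm <-]; exact: chain_value_ge0.
(* This case includes the absence of admissible sequences, that is, a [calA] that misses the zero
   function. *)
have [gy|gy] := eqVneq g +oo.
  rewrite (_ : [set w | _] = setT) ?probability_setT.
    by rewrite lee_fin gerBl mulr_ge0// expR_ge0.
  rewrite -subTset => w _ f Ff.
  rewrite gy mulry gtr0_sg// mul1e addye ?leey// gt_eqF//.
  exact: lt_le_trans (offset_ge0 Ff).
have gfin : g \is a fin_num by rewrite ge0_fin_numE// ltey.
pose e m : R := (m.+1%:R^-1)%R.
pose c m f := 2%:E * (g + (e m)%:E) + offset f.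
pose D m := \bigcup_(f in F) [set w | c m f < excess f w].
have mD m : measurable (D m).
  by apply: fin_bigcup_measurable => // f Ff; exact: measurable_excess.
have mUD : measurable (\bigcup_m D m) by exact: bigcup_measurable.
have DE : [set w | forall f, F f -> excess f w <= 2%:E * g + offset f] =
    ~` (\bigcup_m D m).
  apply/seteqP; split=> w /=.
  - move=> H [m _ [f Ff]]; rewrite /= ltNge => /negP; apply.
    by apply: (le_trans (H f Ff)); rewrite leeD2r// lee_pmul2l// leeDl// lee_fin invr_ge0 ler0n.
  - move=> H f Ff; apply/lee_addgt0Pr => eps eps0.
    have /ltr_add_invr[m] : (0 < eps / 2)%R by rewrite divr_gt0.
    rewrite add0r => me; rewrite leNgt; apply/negP => lt; apply: H.
    exists m => //; exists f => //=; apply: le_lt_trans lt.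
    rewrite /c muleDr ?fin_num_adde_defl// -addeA [X in _ + X]addeC addeA leeD2l//.
    by rewrite -EFinM lee_fin mulrC -ler_pdivlMr// ltW.
rewrite DE probability_setC//.
have PD : P (\bigcup_m D m) <= (2 * expR (- r))%:E.
  apply: mu_bigcup_nondecreasing_le => //.
    move=> i j ij; apply/subsetPset => w [f Ff /= H]; exists f => //=.
    apply: le_lt_trans H; rewrite leeD2r// lee_pmul2l// leeD2l// lee_fin.
    by rewrite lef_pV2 ?posrE// ler_nat.
  move=> m.
  have [_ [S S_adm <-] Sm] : exists2 y,
      [set chain_value S | S in admissible_seq calA] y & y < g + (e m)%:E.
    by apply: ereal_inf_lt; rewrite lteDl// lte_fin invr_gt0.
  have [B [mB PB hB]] := excess_le_chain_value S_adm.
  (* Off [B] the excess stays below the threshold of [D m], because the value of [S] is less than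
     [g + e m]; hence [D m] is contained in [B]. *)
  apply: le_trans PB; apply: le_measure; rewrite ?inE// => w [f Ff /= H].
  apply: contrapT => /hB/(_ f Ff); apply/negP; rewrite -ltNge.
  by apply: le_lt_trans H; rewrite leeD2r// lee_pmul2l// ltW.
rewrite EFinB leeB//.
Qed.

End multiscale_bound.

Theorem theorem1 (d d' : measure_display)
    (Omega : measurableType d) (T : measurableType d') (R : realType)
    (P : probability Omega R) (X : {RV P >-> T})
    (n : nat) (Xs : 'I_n -> {RV P >-> T})
    (V F : set (T -> R)) (A : (T -> R) -> (T -> R)) (k : nat) (r : R)
    (n_gt0 : (0 < n)%N)
    (Xs_iid : iid_copies X Xs)
    (V_adm : admissible_space X V)
    (FV : F `<=` V)
    (F_fin : finite_set F)
    (F0 : F (cst 0%R))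
    (A_F : forall f, F f -> F (A f))
    (r_ge : (ln 2 <= r)%R)
    (A_contr : forall f, F f ->
       Tbar X ((r + k%:R) / n%:R)%R (A f) <= Tbar X ((r + k%:R) / n%:R)%R f)
    (A_card : ((#|` fset_set (A @` F)|)%:R <= expR k%:R :> R)%R) :
  let calA : set (T -> R) := [set (f \- A f)%R | f in F] in
  let l0 : int := Num.floor (ln (r / 3) / ln 2)%R in
  (1 - 2 * expR (- r))%R%:E <=
  P [set w | forall f, F f ->
       (empirical_mean Xs f w)%:E - Tbar X ((r + k%:R) / n%:R)%R f <=
       2%:E * gamma X calA r l0 n +
       mine (2%:E * Tbar X ((2 * r + 1) / n%:R)%R (f \- A f)%R)
            (rad X ((2 * r + 1) / n%:R)%R calA)].
Proof.
have r_gt0 : (0 < r)%R by rewrite (lt_le_trans _ r_ge)// ln_gt0// ltr1n.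
exact: (excess_le_gamma n_gt0 Xs_iid V_adm FV F_fin F0 A_F r_gt0 A_contr A_card).
Qed.
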